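(* Let $\mathcal{X}$ be a real Banach space with $\dim(\mathcal{X})\ge 2$ and let $\kappa,\tau>0$. Then: (i) For any $x_1\in\mathcal{X}$, $$\sup_{x_2\in B_{\mathcal{X}}}\big(\|\kappa x_1+\tau x_2\|\,\|\kappa x_1-\tau x_2\|\big)^{1/2}=\sup_{x_2\in S_{\mathcal{X}}}\big(\|\kappa x_1+\tau x_2\|\,\|\kappa x_1-\tau x_2\|\big)^{1/2}.$$ (ii) $$\mathcal{T}_1(\kappa,\tau,\mathcal{X})=\sup_{x_1\in S_{\mathcal{X}}}\sup_{x_2\in B_{\mathcal{X}}}\big(\|\kappa x_1+\tau x_2\|\,\|\kappa x_1-\tau x_2\|\big)^{1/2}=\sup_{x_1\in B_{\mathcal{X}}}\sup_{x_2\in B_{\mathcal{X}}}\big(\|\kappa x_1+\tau x_2\|\,\|\kappa x_1-\tau x_2\|\big)^{1/2}.$$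
   Context: $B_{\mathcal{X}}$ and $S_{\mathcal{X}}$ denote the closed unit ball and the unit sphere of $\mathcal{X}$. For $\kappa,\tau>0$, $$\mathcal{T}_1(\kappa,\tau,\mathcal{X})=\sup_{x_1,x_2\in S_{\mathcal{X}}}\big(\|\kappa x_1+\tau x_2\|\,\|\kappa x_1-\tau x_2\|\big)^{1/2}.$$ *)

(* Defs.v *)
From HB Require Import structures.
From mathcomp Require Import all_boot all_order all_algebra.
From mathcomp Require Import all_classical all_reals all_analysis.
Set Implicit Arguments.
Unset Strict Implicit.
Unset Printing Implicit Defensive.
Import Order.TTheory GRing.Theory Num.Theory.
Import numFieldNormedType.Exports.
Local Open Scope classical_set_scope.
Local Open Scope ring_scope.

(* [vector] only provides dimension for finite-dimensional spaces; here the
   space may be infinite-dimensional, so [n <= dim X] is the existence of [n]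
   linearly independent vectors. *)
Definition dim_ge (R : realType) (X : normedModType R) (n : nat) : Prop :=
  exists v : 'I_n -> X, forall a : 'I_n -> R,
    \sum_(i < n) a i *: v i = 0 -> forall i, a i = 0.

Definition unit_ball (R : realType) (X : normedModType R) : set X :=
  [set x | `|x| <= 1].

Definition unit_sphere (R : realType) (X : normedModType R) : set X :=
  [set x | `|x| = 1].

Arguments unit_ball {R} X.
Arguments unit_sphere {R} X.

Definition geom_mean (R : realType) (X : normedModType R) (kappa tau : R)
    (x1 x2 : X) : R :=
  Num.sqrt (`|kappa *: x1 + tau *: x2| * `|kappa *: x1 - tau *: x2|).

(* [sup] is real-valued with default 0, but for X nontrivial the set is
   nonempty and it is bounded above by [`|kappa| + `|tau|]. *)
Definition T1 (R : realType) (kappa tau : R) (X : normedModType R) : R :=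
  sup [set geom_mean kappa tau x1 x2
      | x1 in unit_sphere X & x2 in unit_sphere X].

(* Main.v *)
Require Import Defs.
From HB Require Import structures.
From mathcomp Require Import all_boot all_order all_algebra.
From mathcomp Require Import all_classical all_reals all_analysis.
From mathcomp Require Import lra.
Set Implicit Arguments.
Unset Strict Implicit.
Unset Printing Implicit Defensive.
Import Order.TTheory GRing.Theory Num.Theory.
Import numFieldNormedType.Exports.
Local Open Scope classical_set_scope.
Local Open Scope ring_scope.

(** Put [u = kappa *: x1].  The point of the proof is that a point [w] of the
    closed ball of radius [r] can be moved to the sphere of radius [r] without
    decreasing either of [`|u + w|] and [`|u - w| = `|- u + w|]; hence their
    product does not decrease either.  This is where [dim X >= 2] enters: on
    the real line, as long as [`|w| < `|u|], moving [w] either way decreases one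
    of the two norms.

    To find the direction of the move, write [a = u + w], [b = - u + w], and
    let [v] run along a path from [- e] to [e] that avoids [0].  The continuous
    function [`|a + v| - `|a - v|] has opposite values at the two ends, so it
    vanishes at some [v] ([equidistant_direction]).  At that [v] convexity of
    the norm gives [`|a| <= `|a + v|] and [`|a| <= `|a - v|], and also
    [`|b| <= `|b + v|] or [`|b| <= `|b - v|]; so [v] or [- v] is a direction in
    which neither norm has decreased ([common_increase]).  By convexity again,
    neither norm is smaller further out on the same ray ([ler_norm_ray]), and
    one follows this ray up to the sphere ([push_to_sphere]).

    Thus every value taken on a ball is dominated by a value taken on the
    sphere, which gives the equality of suprema in the second variable, and in
    the first one by the symmetry exchanging [(kappa, x1)] and [(tau, x2)].
    The iterated suprema of the second part are first turned into suprema over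
    pairs ([sup_image2]), which is legitimate because the values are bounded by
    [kappa + tau]. *)

(** * Suprema *)

(** Mutually cofinal sets have the same down-closure, and passing to the
    down-closure preserves [sup], default value included. *)
Lemma eq_sup_cofinal (R : realType) (A B : set R) :
  (forall x, A x -> exists2 y, B y & x <= y) ->
  (forall y, B y -> exists2 x, A x & y <= x) ->
  sup A = sup B.
Proof.
move=> AB BA; rewrite -[LHS]sup_down -[RHS]sup_down; congr sup.
apply/seteqP; split=> z /downP[x Ex zx]; apply/downP.
  by have [y By xy] := AB _ Ex; exists y => //; exact: le_trans xy.
by have [y By xy] := BA _ Ex; exists y => //; exact: le_trans xy.
Qed.

Lemma sup_image2 (R : realType) (S T : Type) (f : S -> T -> R)
    (A : set S) (B : set T) (M : R) :
  A !=set0 -> B !=set0 -> (forall x y, A x -> B y -> f x y <= M) ->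
  sup [set f x y | x in A & y in B] =
  sup [set sup [set f x y | y in B] | x in A].
Proof.
move=> [x0 Ax0] [y0 By0] fM.
have leM x : A x -> sup [set f x y | y in B] <= M.
  move=> Ax; apply: ge_sup; first by exists (f x y0), y0.
  by move=> _ [y By <-]; exact: fM.
have le_inner x y : A x -> B y -> f x y <= sup [set f x y | y in B].
  move=> Ax By; apply: ub_le_sup; last by exists y.
  by exists M => _ [z Bz <-]; exact: fM.
apply/eqP; rewrite eq_le; apply/andP; split; apply: ge_sup.
- by exists (f x0 y0), x0 => //; exists y0.
- move=> _ [x Ax [y By <-]]; apply: le_trans (le_inner _ _ Ax By) _.
  apply: ub_le_sup; last by exists x.
  by exists M => _ [z Az <-]; exact: leM.
- by exists (sup [set f x0 y | y in B]), x0.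
move=> _ [x Ax <-]; apply: ge_sup; first by exists (f x y0), y0.
move=> _ [y By <-]; apply: ub_le_sup; last by exists x => //; exists y.
by exists M => _ [z Az [t Bt <-]]; exact: fM.
Qed.

(** * Pushing a point of the ball to the sphere *)

Section Push.
Variables (R : realType) (X : normedModType R).
Implicit Types (a b u v w e : X) (r t s : R).

Lemma dim_ge2_pair : dim_ge X 2 ->
  exists e1 e2 : X, forall s t, s *: e1 + t *: e2 = 0 -> s = 0 /\ t = 0.
Proof.
move=> [v vfree]; exists (v ord0), (v ord_max) => s t st0.
have /vfree st : \sum_(i < 2) (if i == ord0 then s else t) *: v i = 0.
  rewrite big_ord_recl big_ord1 /= -[RHS]st0; congr (_ + _ *: v _).
  exact/val_inj.
by split; [exact: (st ord0) | exact: (st ord_max)].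
Qed.

Lemma dim_ge2_sphere_neq0 : dim_ge X 2 -> unit_sphere X !=set0.
Proof.
move=> /dim_ge2_pair[e1 [e2 free]].
have e1N0 : e1 != 0.
  apply/eqP => e10; have [] := free 1 0.
    by rewrite e10 scaler0 scale0r addr0.
  by move=> /eqP; rewrite oner_eq0.
by exists (`|e1|^-1 *: e1); rewrite /unit_sphere /= normrZ normfV normr_id
  mulVf// normr_eq0.
Qed.

(** An intermediate value argument: [`|a + v| - `|a - v|] is odd in [v], so it
    vanishes somewhere on any path from [- e] to [e]. *)
Lemma equidistant_direction a r : dim_ge X 2 -> 0 < r ->
  exists v, [/\ v != 0, `|v| <= r & `|a + v| = `|a - v|].
Proof.
move=> /dim_ge2_pair[e1 [e2 free]] r0.
(* [p] follows a parabola from [- e1] to [e1], away from [0] since its two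
   coordinates have no common zero *)
pose p s : X := s *: e1 + (1 - s ^+ 2) *: e2.
have pN0 s : p s != 0.
  apply/eqP => /free[-> /eqP].
  by rewrite expr0n subr0 oner_eq0.
pose K := `|e1| + `|e2|.
have K0 : 0 <= K by rewrite addr_ge0.
(* scaling by [c] brings the whole path into the ball of radius [r] *)
pose c := r / (K + 1).
have c0 : 0 < c by rewrite divr_gt0// ltr_wpDl.
pose q s : X := c *: p s.
have cq : continuous q.
  move=> s; apply: cvgZr; apply: cvgD; first exact: cvgZl.
  apply: cvgZl; apply: cvgB; first exact: cvg_cst.
  exact: exprn_continuous.
pose h s := `|a + q s| - `|a - q s|.
have ch : continuous h.
  move=> s; apply: cvgB; apply: cvg_norm.
    by apply: cvgD; [exact: cvg_cst | exact: cq].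
  by apply: cvgB; [exact: cvg_cst | exact: cq].
have qN1 : q (- 1) = - q 1.
  by rewrite /q /p sqrrN !expr1n subrr !scale0r !addr0 !scaleNr scalerN.
have hN1 : h (- 1) = - h 1 by rewrite /h qN1 opprK opprB.
have N11 : -1 <= 1 :> R by lra.
have [||s sI hs0] := @IVT R h (- 1) 1 0 N11.
- exact: continuous_subspaceT.
- rewrite hN1 ge_min le_max.
  by rewrite oppr_le0 oppr_ge0 [X in _ && X]orbC andbb le_total.
exists (q s); split; last by apply/eqP; rewrite -subr_eq0; apply/eqP.
  by rewrite scaler_eq0 negb_or gt_eqF//= pN0.
have pK : `|p s| <= K.
  move: sI; rewrite in_itv/= => /andP[s1 s2].
  rewrite (le_trans (ler_normD _ _))// lerD// normrZ ler_piMl//.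
    by rewrite ler_norml s1.
  by rewrite ler_norml; apply/andP; split; nra.
rewrite normrZ gtr0_norm// /c mulrAC ler_pdivrMr ?ltr_wpDl//.
by rewrite ler_wpM2l ?(ltW r0)// (le_trans pK)// lerDl.
Qed.

Lemma ler_norm_midpoint b v : `|b| *+ 2 <= `|b + v| + `|b - v|.
Proof.
rewrite -normrMn (le_trans _ (ler_normD _ _))//.
by rewrite addrACA subrr addr0 mulr2n.
Qed.

Lemma common_increase a b r : dim_ge X 2 -> 0 < r ->
  exists v, [/\ v != 0, `|v| <= r, `|a| <= `|a + v| & `|b| <= `|b + v|].
Proof.
move=> hdim r0; have [v [vN0 vr av]] := equidistant_direction a hdim r0.
have := ler_norm_midpoint a v; have := ler_norm_midpoint b v => hb ha.
case: (lerP `|b| `|b + v|) => bv; first by exists v; split=> //; lra.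
by exists (- v); split; rewrite ?oppr_eq0 ?normrN//; lra.
Qed.

(** Convexity: [a + v] is a barycentre of [a] and [a + t *: v] when [1 <= t]. *)
Lemma ler_norm_ray a v t : `|a| <= `|a + v| -> 1 <= t ->
  `|a| <= `|a + t *: v|.
Proof.
move=> av t1; have t0 : 0 <= t by lra.
have : `|t *: (a + v)| <= `|(t - 1) *: a| + `|a + t *: v|.
  apply: le_trans (ler_normD _ _).
  by rewrite addrA scalerBl scale1r subrK scalerDr.
rewrite !normrZ (ger0_norm t0) ger0_norm ?subr_ge0// => h.
have := ler_wpM2l t0 av; lra.
Qed.

Lemma ray_meets_sphere w v r : v != 0 -> `|w + v| <= r ->
  exists2 t, 1 <= t & `|w + t *: v| = r.
Proof.
move=> vN0 wvr; have v0 : 0 < `|v| by rewrite normr_gt0.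
have r0 : 0 <= r by exact: le_trans wvr.
pose T := 1 + (r + `|w|) / `|v|.
have T1 : 1 <= T by rewrite lerDl divr_ge0// addr_ge0.
have cN : continuous (fun t => `|w + t *: v|).
  move=> t; apply: cvg_norm; apply: cvgD; first exact: cvg_cst.
  exact: cvgZl.
have rT : r <= `|w + T *: v|.
  have : `|T *: v| <= `|w + T *: v| + `|w|.
    by rewrite -[X in `|X| <= _](addKr w) addrC (le_trans (ler_normB _ _)).
  rewrite normrZ ger0_norm ?(le_trans ler01)// /T mulrDl mul1r divfK ?gt_eqF//.
  lra.
have [||t tI ht] := @IVT R (fun t => `|w + t *: v|) 1 T r T1.
- exact: continuous_subspaceT.
- by rewrite scale1r ge_min wvr le_max rT orbT.
by exists t => //; move: tI; rewrite in_itv/= => /andP[].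
Qed.

(** Used with [b = - a], in the form [`|- a + w| = `|a - w|]. *)
Lemma push_to_sphere a b w r : dim_ge X 2 -> `|w| <= r ->
  exists w', [/\ `|w'| = r, `|a + w| <= `|a + w'| & `|b + w| <= `|b + w'|].
Proof.
move=> hdim; rewrite le_eqVlt => /predU1P[wr|wr]; first by exists w.
have rw0 : 0 < r - `|w| by rewrite subr_gt0.
have [v [vN0 vr av bv]] := common_increase (a + w) (b + w) hdim rw0.
have wvr : `|w + v| <= r by have := ler_normD w v; lra.
have [t t1 tr] := ray_meets_sphere vN0 wvr.
by exists (w + t *: v); rewrite !addrA; split=> //; exact: ler_norm_ray.
Qed.

End Push.

(** * The geometric mean *)

Section GeomMean.
Variables (R : realType) (X : normedModType R).
Implicit Types (kappa tau : R) (x y : X).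

Lemma geom_meanC kappa tau x y :
  geom_mean kappa tau x y = geom_mean tau kappa y x.
Proof. by rewrite /geom_mean [tau *: y + _]addrC [`|tau *: y - _|]distrC. Qed.

Lemma geom_mean_le_sphere_r kappa tau x y : dim_ge X 2 -> 0 < tau ->
  `|y| <= 1 ->
  exists2 z, `|z| = 1 & geom_mean kappa tau x y <= geom_mean kappa tau x z.
Proof.
move=> hdim tau0 y1.
have tyt : `|tau *: y| <= tau by rewrite normrZ gtr0_norm// ler_piMr// ltW.
have [w [wt aw bw]] :=
  push_to_sphere (kappa *: x) (- (kappa *: x)) hdim tyt.
exists (tau^-1 *: w).
  by rewrite normrZ wt gtr0_norm ?invr_gt0// mulVf ?gt_eqF.
rewrite /geom_mean scalerA divff ?gt_eqF// scale1r ler_wsqrtr// ler_pM//.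
by rewrite -normrN opprB addrC (le_trans bw)// addrC distrC.
Qed.

Lemma geom_mean_le_sphere_l kappa tau x y : dim_ge X 2 -> 0 < kappa ->
  `|x| <= 1 ->
  exists2 z, `|z| = 1 & geom_mean kappa tau x y <= geom_mean kappa tau z y.
Proof.
move=> hdim kappa0 x1.
have [z z1 le_z] := geom_mean_le_sphere_r tau y hdim kappa0 x1.
by exists z; rewrite // [leLHS]geom_meanC [leRHS]geom_meanC.
Qed.

Lemma geom_mean_bounded kappa tau x y : 0 < kappa -> 0 < tau ->
  `|x| <= 1 -> `|y| <= 1 -> geom_mean kappa tau x y <= kappa + tau.
Proof.
move=> kappa0 tau0 x1 y1.
have kt0 : 0 <= kappa + tau by rewrite addr_ge0// ltW.
have le_kt : `|kappa *: x| + `|tau *: y| <= kappa + tau.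
  by rewrite !normrZ !gtr0_norm// lerD// ler_piMr// ltW.
rewrite /geom_mean -[leRHS](ger0_norm kt0) -sqrtr_sqr ler_wsqrtr// expr2.
rewrite ler_pM//; first exact: le_trans (ler_normD _ _) le_kt.
exact: le_trans (ler_normB _ _) le_kt.
Qed.

End GeomMean.

Theorem proposition1 (R : realType) (X : completeNormedModType R)
    (hdim : dim_ge X 2) (kappa tau : R) (hkappa : 0 < kappa) (htau : 0 < tau) :
  (forall x1 : X,
     sup [set geom_mean kappa tau x1 x2 | x2 in unit_ball X] =
     sup [set geom_mean kappa tau x1 x2 | x2 in unit_sphere X]) /\
  (T1 kappa tau X =
     sup [set sup [set geom_mean kappa tau x1 x2 | x2 in unit_ball X]
         | x1 in unit_sphere X] /\
   sup [set sup [set geom_mean kappa tau x1 x2 | x2 in unit_ball X]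
       | x1 in unit_sphere X] =
     sup [set sup [set geom_mean kappa tau x1 x2 | x2 in unit_ball X]
         | x1 in unit_ball X]).
Proof.
have sub_ball (x : X) : unit_sphere X x -> unit_ball X x.
  by rewrite /unit_sphere /unit_ball /= => ->.
have [e Se] := dim_ge2_sphere_neq0 hdim.
have Be := sub_ball _ Se.
split=> [x1|].
  apply: eq_sup_cofinal => _ [y By <-].
    have [z Sz yz] := geom_mean_le_sphere_r kappa x1 hdim htau By.
    by exists (geom_mean kappa tau x1 z) => //; exists z.
  by exists (geom_mean kappa tau x1 y) => //; exists y => //; exact: sub_ball.
rewrite -!(@sup_image2 _ _ _ _ _ _ (kappa + tau)).
- split; apply: eq_sup_cofinal => _ [x Ax [y By <-]].
  + exists (geom_mean kappa tau x y) => //; exists x => //; exists y => //.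
    exact: sub_ball.
  + have [z Sz yz] := geom_mean_le_sphere_r kappa x hdim htau By.
    by exists (geom_mean kappa tau x z) => //; exists x => //; exists z.
  + exists (geom_mean kappa tau x y) => //; exists x; first exact: sub_ball.
    by exists y.
  + have [z Sz yz] := geom_mean_le_sphere_l tau y hdim hkappa Ax.
    by exists (geom_mean kappa tau z y) => //; exists z => //; exists y.
- by exists e.
- by exists e.
- by move=> x y Ax By; exact: geom_mean_bounded.
- by exists e.
- by exists e.
- by move=> x y Ax By; apply: geom_mean_bounded => //; exact: sub_ball.
Qed.
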